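(* Let $G=(V,E)$ be a finite directed graph with edge weights $w:E\to\mathbb{R}$ and source $s\in V$. Consider a frontier-based relaxation process producing distance vectors $d^{(t)}:V\to\mathbb{R}\cup\{+\infty\}$ and frontiers $F^{(t)}\subseteq V$ for $t=0,1,2,\dots$, as follows. Initially $d^{(0)}(s)=0$, $d^{(0)}(v)=+\infty$ for $v\neq s$, and $F^{(0)}=\{s\}$. For each $t\ge 1$, outer iteration $t$ starts from the vector $d^{(t-1)}$ and performs a finite sequence of relaxation operations, each of the form $d(y)\leftarrow\min\{d(y),\,d(x)+w(x,y)\}$ for some edge $(x,y)\in E$ (evaluated with the current values), where every relaxation performed in iteration $t$ is on an edge whose tail lies in $F^{(t-1)}$ (these may include additional multi-hop ''jump propagation'' relaxations), and every edge whose tail lies in $F^{(t-1)}$ is relaxed at least once during iteration $t$. Let $d^{(t)}$ be the vector at the end of iteration $t$ and $F^{(t)}=\{v\in V: d^{(t)}(v)<d^{(t-1)}(v)\}$. If $G$ has no negative-weight cycle reachable from $s$, then \[ d^{(|V|-1)}(v)=d^\ast(v)\quad\text{for all } v\in V. \] Moreover, if there exist $v\in V$ and $t\ge |V|$ with $d^{(t)}(v)<d^{(|V|-1)}(v)$ (a strict improvement after $|V|-1$ iterations), then $G$ contains a negative-weight cycle reachable from $s$.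
   Context: A directed $s\to v$ path is a sequence of edges $(x_0,x_1),\dots,(x_{\ell-1},x_\ell)\in E$ with $x_0=s$, $x_\ell=v$ (vertices need not be distinct); its length is the sum of its edge weights, and the path with $0$ edges from $s$ to $s$ has length $0$. $d^\ast(v)$ denotes the true shortest-path distance from $s$ to $v$, i.e. the infimum of the lengths of all directed $s\to v$ paths ($+\infty$ if no such path exists). A negative-weight cycle reachable from $s$ is a directed cycle of negative total weight containing a vertex reachable from $s$. Convention: $+\infty+a=+\infty$. *)

(* Defs.v *)
From mathcomp Require Export all_boot all_order all_algebra.
From mathcomp Require Export classical_sets reals constructive_ereal ereal.

Set Implicit Arguments.
Unset Strict Implicit.
Unset Printing Implicit Defensive.

Import Order.TTheory GRing.Theory Num.Theory.

Local Open Scope classical_set_scope.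
Local Open Scope ring_scope.
Local Open Scope ereal_scope.

(* A directed graph is E : rel V on a finType V (loops allowed).  The weight
   function is total, but only its values on pairs (x, y) with E x y are ever
   used.  A path x_0, x_1, ..., x_l is given, as in path.v, by its source x_0 and
   the sequence [:: x_1; ...; x_l]. *)

Definition path_length (R : realType) (V : finType) (w : V -> V -> R)
    (x : V) (p : seq V) : R :=
  (\sum_(a <- pairmap w x p) a)%R.

Definition distance (R : realType) (V : finType) (E : rel V) (w : V -> V -> R)
    (s v : V) : \bar R :=
  ereal_inf [set (path_length w s p)%:E | p in [set p | path E s p /\ last s p = v]].

Definition cycle_length (R : realType) (V : finType) (w : V -> V -> R)
    (c : seq V) : R :=
  if c is x :: p then path_length w x (rcons p x) else 0%R.

(* Cycles have no repeated vertex (ucycle); a loop is a cycle.  The empty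
   sequence is excluded since it has length 0. *)
Definition reachable_negative_cycle (R : realType) (V : finType) (E : rel V)
    (w : V -> V -> R) (s : V) : Prop :=
  exists c : seq V,
    [/\ ucycle E c, (cycle_length w c < 0)%R
      & exists2 x, x \in c & connect E s x].

Definition relax (R : realType) (V : finType) (w : V -> V -> R)
    (d : V -> \bar R) (e : V * V) : V -> \bar R :=
  fun v => if v == e.2 then Order.min (d e.2) (d e.1 + (w e.1 e.2)%:E) else d v.

Definition relax_iteration (R : realType) (V : finType) (E : rel V)
    (w : V -> V -> R) (F : {set V}) (d d' : V -> \bar R) : Prop :=
  exists r : seq (V * V),
    [/\ forall e, e \in r -> E e.1 e.2 /\ e.1 \in F,
        forall x y, x \in F -> E x y -> (x, y) \in r
      & d' =1 foldl (relax w) d r].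

(* Distance vectors take values in \bar R; the value -oo never occurs, as it is
   neither an initial value nor produced by a relaxation. *)
Definition frontier_process (R : realType) (V : finType) (E : rel V)
    (w : V -> V -> R) (s : V) (d : nat -> V -> \bar R) (F : nat -> {set V})
    : Prop :=
  [/\ forall v, d 0%N v = if v == s then 0 else +oo,
      F 0%N = [set s]%SET,
      forall t, relax_iteration E w (F t) (d t) (d t.+1)
    & forall t, F t.+1 = [set v | d t.+1 v < d t v]%SET].

(* Main.v *)
Require Import Defs.
From mathcomp Require Import boolp.

Set Implicit Arguments.
Unset Strict Implicit.
Unset Printing Implicit Defensive.

Import Order.TTheory GRing.Theory Num.Theory.

Local Open Scope ereal_scope.

(** The frontier never loses information: at every time [t], an edge whose tail
    is outside [F t] is already relaxed with respect to [d t].  Hence iteration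
    [t + 1] effectively relaxes all edges, and as in Bellman-Ford [d t v] is at
    most the length of any walk from [s] to [v] with at most [t] edges.
    Conversely every finite value of [d t] is the length of a walk, so
    [distance <= d t].  Without reachable negative cycles, closed subwalks can be
    cut out without increasing the length, so walks with fewer than [#|V|] edges
    suffice, and [d (#|V| - 1)] is both the distance and a lower bound for all
    later vectors. *)

Section PathLength.
Variables (R : realType) (V : finType) (E : rel V) (w : V -> V -> R).
Implicit Types (x y : V) (p q : seq V).

Lemma path_length_cat x p q :
  path_length w x (p ++ q) = (path_length w x p + path_length w (last x p) q)%R.
Proof. by rewrite /path_length pairmap_cat big_cat. Qed.

Lemma path_length_rcons x p y :
  path_length w x (rcons p y) = (path_length w x p + w (last x p) y)%R.
Proof. by rewrite -cats1 path_length_cat /path_length /= big_seq1. Qed.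

Lemma distance_le s p : path E s p ->
  distance E w s (last s p) <= (path_length w s p)%:E.
Proof. by move=> Ep; apply: ereal_inf_lbound; exists p. Qed.

End PathLength.

(** Searching the tail first finds the repetition that starts last: no vertex repeats after its
    starting point, so the closed walk between the two occurrences is a simple cycle. An empty [b]
    is a loop. *)
Lemma not_uniq_split_cycle (T : eqType) (x : T) (p : seq T) :
  ~~ uniq (x :: p) ->
  exists p1 b p2, p = p1 ++ rcons b (last x p1) ++ p2 /\ uniq (last x p1 :: b).
Proof.
elim: p x => [//|y l IHl] x.
rewrite cons_uniq negb_and negbK.
have [uyl|/IHl[p1 [b [p2 [-> ub]]]] _] := boolP (uniq (y :: l)); last first.
  by exists (y :: p1), b, p2.
rewrite orbF => xyl; case/splitPr: xyl uyl => b p2 uyl.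
exists [::], b, p2; rewrite /= cat_rcons; split=> //.
by move: uyl; rewrite cat_uniq /= => /and3P[-> /norP[->]].
Qed.

Lemma uniq_path_le (R : realType) (V : finType) (E : rel V) (w : V -> V -> R)
    (s : V) (p : seq V) :
  ~ reachable_negative_cycle E w s -> path E s p ->
  exists q, [/\ path E s q, last s q = last s p, uniq (s :: q)
    & (path_length w s q <= path_length w s p)%R].
Proof.
move=> noneg; have [n] := ubnP (size p); elim: n p => // n IHn p size_p Ep.
have [up|] := boolP (uniq (s :: p)); first by exists p.
move/not_uniq_split_cycle => [p1 [b [p2 [def_p ub]]]].
move: Ep size_p; rewrite {p}def_p.
rewrite !cat_path last_rcons => /and3P[Ep1 Eb Ep2] size_p.
have b_ge0 : (0 <= path_length w (last s p1) (rcons b (last s p1)))%R.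
  rewrite leNgt; apply/negP => b_lt0; apply: noneg.
  exists (last s p1 :: b); split => //.
    by rewrite /ucycle /= Eb -cons_uniq.
  by exists (last s p1); rewrite ?mem_head//; apply/connectP; exists p1.
(* The removed cycle has at least one edge, even when [b] is empty, so [p1 ++ p2] is strictly
   shorter. *)
have [||q [Eq lq uq le_q]] := IHn (p1 ++ p2).
- move: size_p; rewrite ltnS; apply: leq_trans.
  by rewrite !size_cat size_rcons addSn addnS !ltnS leq_add2l leq_addl.
- by rewrite cat_path Ep1.
exists q; split=> //; first by rewrite lq !last_cat last_rcons.
apply: (le_trans le_q); rewrite !path_length_cat last_rcons lerD2l.
by rewrite lerDr.
Qed.

Section Relaxation.
Variables (R : realType) (V : finType) (E : rel V) (w : V -> V -> R).
Implicit Types (d : V -> \bar R) (r : seq (V * V)).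

Lemma relax_le d e v : relax w d e v <= d v.
Proof. by rewrite /relax; case: eqP => // ->; rewrite ge_min lexx. Qed.

Lemma foldl_relax_le d r v : foldl (relax w) d r v <= d v.
Proof.
by elim: r d => [//|e r IHr] d /=; apply: le_trans (relax_le _ e _).
Qed.

(** Relaxations before that of [(x, y)] can only lower the value at [x], and later ones can only
    lower the value at [y]. *)
Lemma foldl_relax_edge d r x y : (x, y) \in r ->
  foldl (relax w) d r y <= d x + (w x y)%:E.
Proof.
elim: r d => [//|e r IHr] d; rewrite inE => /predU1P[<-|/IHr le_r] /=.
  apply: (le_trans (foldl_relax_le _ _ _)).
  by rewrite /relax /= eqxx ge_min lexx orbT.
by apply: (le_trans (le_r _)); apply: leeD2r; apply: relax_le.
Qed.

(** The invariant behind the lower bound; it also rules out [-oo]. *)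
Definition walk_valued s d := forall v,
  d v = +oo \/
  exists p, [/\ path E s p, last s p = v & d v = (path_length w s p)%:E].

Lemma walk_valued_distance s d v : walk_valued s d -> distance E w s v <= d v.
Proof.
move=> /(_ v)[->|[p [Ep <- ->]]]; first exact: leey.
exact: distance_le.
Qed.

Lemma relax_walk_valued s d e : E e.1 e.2 -> walk_valued s d ->
  walk_valued s (relax w d e).
Proof.
move=> Ee ds v; rewrite /relax; case: eqP => [->|_]; last exact: ds.
rewrite minEle; case: ifP => _; first exact: ds.
case: (ds e.1) => [->|[p [Ep lp ->]]]; first by left.
right; exists (rcons p e.2); rewrite rcons_path last_rcons path_length_rcons.
by rewrite Ep lp Ee EFinD.
Qed.

Lemma foldl_relax_walk_valued s d r : (forall e, e \in r -> E e.1 e.2) ->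
  walk_valued s d -> walk_valued s (foldl (relax w) d r).
Proof.
elim: r d => [//|e r IHr] d Er ds /=; apply: IHr => [f fr|].
  by apply: Er; rewrite inE fr orbT.
by apply: relax_walk_valued ds; apply: Er; rewrite mem_head.
Qed.

End Relaxation.

Section Process.
Variables (R : realType) (V : finType) (E : rel V) (w : V -> V -> R) (s : V).
Variables (d : nat -> V -> \bar R) (F : nat -> {set V}).
Hypothesis proc : frontier_process E w s d F.

Lemma process_nonincreasing t v : d t.+1 v <= d t v.
Proof.
have [_ _ /(_ t)[r [_ _ ->]] _] := proc; exact: foldl_relax_le.
Qed.

Lemma process_walk_valued t : walk_valued E w s (d t).
Proof.
have [d0 _ step _] := proc.
elim: t => [|t IHt] v.
  rewrite d0; case: eqP => [->|_]; [right|by left].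
  by exists [::]; rewrite /path_length /= big_nil.
have [r [Er _ ->]] := step t.
by apply: foldl_relax_walk_valued IHt _ => e /Er[].
Qed.

Lemma process_frontier_edge t x y : x \in F t -> E x y ->
  d t.+1 y <= d t x + (w x y)%:E.
Proof.
move=> Fx Exy; have [_ _ /(_ t)[r [_ Fr ->]] _] := proc.
by apply: foldl_relax_edge; apply: Fr.
Qed.

(** If [x] did not improve in the last iteration, its value is the previous one; the edge was either
    relaxed in that iteration or settled before it, and the value at [y] has not risen since. *)
Lemma process_settled_edge t x y : x \notin F t -> E x y ->
  d t y <= d t x + (w x y)%:E.
Proof.
have [d0 F0 _ FS] := proc.
move=> + Exy; elim: t => [|t IHt].
  (* At time 0, a vertex outside the frontier differs from [s] and has value [+oo]. *)
  by rewrite F0 inE (d0 x) => /negPf ->; rewrite addye ?leey.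
rewrite FS inE -leNgt => d_ge.
have -> : d t.+1 x = d t x.
  by apply/le_anti; rewrite d_ge process_nonincreasing.
have [Fx|nFx] := boolP (x \in F t); first exact: process_frontier_edge.
by apply: le_trans (IHt nFx); apply: process_nonincreasing.
Qed.

Lemma process_edge t x y : E x y -> d t.+1 y <= d t x + (w x y)%:E.
Proof.
move=> Exy; have [Fx|nFx] := boolP (x \in F t).
  exact: process_frontier_edge.
by apply: le_trans (process_settled_edge nFx Exy); apply: process_nonincreasing.
Qed.

Lemma process_path_le t p : path E s p -> (size p <= t)%N ->
  d t (last s p) <= (path_length w s p)%:E.
Proof.
elim: t p => [|t IHt] p; case/lastP: p => [|p y].
- by have [-> _ _ _] := proc; rewrite /= eqxx /path_length big_nil.
- by rewrite size_rcons.
- move=> _ _; apply: le_trans (process_nonincreasing _ _) _.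
  exact: (IHt [::]).
- rewrite rcons_path size_rcons last_rcons => /andP[Ep Ey] size_p.
  rewrite path_length_rcons EFinD.
  by apply: (le_trans (process_edge _ Ey)); apply: leeD2r; apply: IHt.
Qed.

Lemma process_distance : ~ reachable_negative_cycle E w s ->
  forall v, d (#|V| - 1)%N v = distance E w s v.
Proof.
move=> noneg v; apply/le_anti/andP; split; last first.
  exact/walk_valued_distance/process_walk_valued.
apply: le_ereal_inf_tmp => _ [p [Ep <-] <-].
have [q [Eq <- uq le_qp]] := uniq_path_le noneg Ep.
apply: (@le_trans _ _ (path_length w s q)%:E); last by rewrite lee_fin.
apply: process_path_le => //.
(* The simple walk [s :: q] has at most [#|V|] vertices, hence [q] at most [#|V| - 1] edges; the
   truncated subtraction calls for [#|V|] to be positive. *)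
have V_gt0 : (0 < #|V|)%N by apply/card_gt0P; exists s.
by rewrite -ltnS subn1 prednK // -[(size q).+1]/(size (s :: q)) -(card_uniqP uq) max_card.
Qed.

End Process.

Theorem theorem2p3 (R : realType) (V : finType) (E : rel V) (w : V -> V -> R)
    (s : V) (d : nat -> V -> \bar R) (F : nat -> {set V})
    (Hproc : frontier_process E w s d F) :
  (~ reachable_negative_cycle E w s ->
     forall v : V, d (#|V| - 1)%N v = distance E w s v) /\
  ((exists (v : V) (t : nat), (#|V| <= t)%N /\ d t v < d (#|V| - 1)%N v) ->
     reachable_negative_cycle E w s).
Proof.
split; first exact: process_distance Hproc.
(* Without a reachable negative cycle, a strict improvement would bring [d t v] below the
   distance. *)
move=> [v [t [_ d_lt]]]; apply: contrapT => noneg.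
move: d_lt; rewrite (process_distance Hproc noneg) ltNge => /negP; apply.
exact/walk_valued_distance/(process_walk_valued Hproc).
Qed.
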